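(* Let $\{L_m\}_{m=1}^{\infty}$ be the sequence of Lucas numbers, and let $n\in\mathbb{N}$. Then: (1) each of $L_{12n+4}$ and $L_{12n-4}$ is congruent to $5$ or $7$ modulo $8$; (2) $L_{12n+2}\equiv 3 \pmod 8$ and $L_{12n-2}\equiv 3\pmod 8$; (3) each of $L_{12n+2}-2$ and $L_{12n-2}-2$ is a square of an integer.
   Context: The Lucas numbers are the integers defined by $L_1=1$, $L_2=3$ and the Fibonacci recurrence $L_{m+2}=L_{m+1}+L_m$ for $m\geq 1$. Here $\mathbb{N}=\{1,2,3,\dots\}$, so all indices occurring are positive. *)

(* Defs.v *)
From mathcomp Require Import all_boot all_order all_algebra.

Set Implicit Arguments.
Unset Strict Implicit.
Unset Printing Implicit Defensive.

Import GRing.Theory.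
Local Open Scope ring_scope.

(* The sequence is indexed by m >= 1; the value 2 at index 0 is the one forced
   by extending the recurrence backwards. *)
Fixpoint lucas (m : nat) : int :=
  match m with
  | 0%N => 2
  | m1.+1 => match m1 with
             | 0%N => 1
             | m2.+1 => lucas m1 + lucas m2
             end
  end.

Lemma lucas1 : lucas 1 = 1. Proof. by []. Qed.

Lemma lucas2 : lucas 2 = 3. Proof. by []. Qed.

Lemma lucasSS (m : nat) : lucas m.+2 = lucas m.+1 + lucas m.
Proof. by []. Qed.

(* Main.v *)
Require Import Defs.
From mathcomp Require Import all_boot all_order all_algebra.
From mathcomp Require Import ring zify.

(** The indices [12n + 4], [12n - 4], [12n + 2], [12n - 2] each lie in one fixed
    class modulo 12, and the Lucas sequence modulo 8 has period 12 because
    [L_(m+12) = 144 L_(m+1) + 89 L_m] with [144 = 0] and [89 = 1] modulo 8.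
    The congruences are therefore read off the values
    [L_4 = 7], [L_8 = 47], [L_2 = 3], [L_10 = 123].

    For the squares, [12n + 2] and [12n - 2] are doubles of the odd numbers
    [6n + 1] and [6n - 1], and the doubling formula
    [L_(2k) = L_k ^ 2 - 2 (-1) ^ k] gives [L_(2k) - 2 = L_k ^ 2] for odd [k].
    The doubling formula rests on the Cassini identity for Lucas numbers. *)

Import GRing.Theory.
Local Open Scope ring_scope.

(** One step of the recurrence, [(x, y) -> (y, x + y)], negates the quadratic
    form [y ^ 2 - x y - x ^ 2]; at [(L_0, L_1) = (2, 1)] its value is [-5]. *)
Lemma lucas_cassini (m : nat) :
  lucas m.+1 ^+ 2 = lucas m * lucas m.+1 + lucas m ^+ 2 - 5 * (-1) ^+ m.
Proof.
elim: m => [|m IHm]; first by [].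
by rewrite lucasSS (exprS _ m) sqrrD mulrDr -expr2 IHm; ring.
Qed.

(** The recurrence links [L_(2k+2)] to both [L_(2k+1)] and [L_(2k)], so the
    two formulas are proved together. *)
Lemma lucas_double_succ (k : nat) :
  lucas k.*2 = lucas k ^+ 2 - 2 * (-1) ^+ k /\
  lucas k.*2.+1 = lucas k * lucas k.+1 - (-1) ^+ k.
Proof.
elim: k => [|k [IHe IHo]]; first by [].
have even_succ : lucas k.+1.*2 = lucas k.+1 ^+ 2 - 2 * (-1) ^+ k.+1.
  by rewrite doubleS lucasSS IHo IHe lucas_cassini (exprS _ k); ring.
split=> //.
have -> : lucas k.+1.*2.+1 = lucas k.+1.*2 + lucas k.*2.+1 by [].
by rewrite even_succ IHo (lucasSS k) (exprS _ k); ring.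
Qed.

Lemma lucas_double_odd (k : nat) :
  odd k -> lucas k.*2 - 2 = lucas k ^+ 2.
Proof.
move=> odd_k; have [-> _] := lucas_double_succ k.
by rewrite -signr_odd odd_k; ring.
Qed.

Lemma lucas_add12 (m : nat) :
  lucas (m + 12) = 144 * lucas m.+1 + 89 * lucas m.
Proof. by rewrite !addnS addn0 !lucasSS; ring. Qed.

Lemma lucas_mod8_period (m q : nat) :
  (lucas (m + 12 * q) = lucas m %[mod 8])%Z.
Proof.
elim: q => [|q IHq]; first by rewrite muln0 addn0.
rewrite mulnSr addnA lucas_add12 -IHq.
set a := lucas _.+1; set b := lucas _.
have -> : 144 * a + 89 * b = (18 * a + 11 * b) * 8 + b by ring.
exact: modzMDl.
Qed.

Theorem corollary1 (n : nat) (hn : (1 <= n)%N) :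
  [/\ ((lucas (12 * n + 4) = 5 %[mod 8])%Z \/
       (lucas (12 * n + 4) = 7 %[mod 8])%Z) /\
      ((lucas (12 * n - 4) = 5 %[mod 8])%Z \/
       (lucas (12 * n - 4) = 7 %[mod 8])%Z),
      (lucas (12 * n + 2) = 3 %[mod 8])%Z /\
      (lucas (12 * n - 2) = 3 %[mod 8])%Z
    & (exists k : int, lucas (12 * n + 2) - 2 = k ^+ 2) /\
      (exists k : int, lucas (12 * n - 2) - 2 = k ^+ 2)].
Proof.
case: n hn => // q _.
have sub4 : (12 * q.+1 - 4 = 8 + 12 * q)%N by lia.
have sub2 : (12 * q.+1 - 2 = 10 + 12 * q)%N by lia.
split.
- split; right; first by rewrite addnC lucas_mod8_period.
  by rewrite sub4 lucas_mod8_period.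
- split; first by rewrite addnC lucas_mod8_period.
  by rewrite sub2 lucas_mod8_period.
split.
- exists (lucas (6 * q.+1 + 1)); rewrite -lucas_double_odd; last by lia.
  by congr (lucas _ - 2); lia.
exists (lucas (6 * q + 5)); rewrite -lucas_double_odd; last by lia.
by congr (lucas _ - 2); lia.
Qed.
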